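(* Let $d\in\mathbb{C}$ with $d\ne0,-1,-2,\dots$, and let $n\in\mathbb{N}_0$. Then $$\sum_{k=0}^{\lfloor n/2\rfloor}\frac{1}{2^{2k}}\,\frac{\binom{k+d+1}{k}}{\binom{k+d}{k}}\,\frac{\binom{2k}{k}}{\binom{k+2}{k}}\binom{n}{2k}=\frac{2^{n+1}}{d+1}\cdot\frac{n^2+n(4d+3)+6(d+1)}{(n+3)(n+4)}\cdot\frac{\left(\frac32\right)_n}{(3)_n}.$$
   Context: $\mathbb{N}_0=\{0,1,2,\dots\}$; $\lfloor\cdot\rfloor$ is the floor function. The Pochhammer symbol is $(\alpha)_0=1$, $(\alpha)_m=\alpha(\alpha+1)\cdots(\alpha+m-1)$ for $m\ge1$. Binomial coefficients with non-integer upper entry are generalized binomial coefficients; explicitly, for $k\in\mathbb{N}_0$, $\binom{k+d}{k}=\frac{(d+1)_k}{k!}$ and $\binom{k+d+1}{k}=\frac{(d+2)_k}{k!}$. *)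

(* Defs.v *)
(* MathComp; the complex numbers are R[i] over a realType R. *)
From mathcomp Require Import all_boot all_order all_algebra.
From mathcomp Require Import reals.
From mathcomp Require Import complex ring.

Set Implicit Arguments.
Unset Strict Implicit.
Unset Printing Implicit Defensive.

Import GRing.Theory.
Local Open Scope ring_scope.

Definition pochhammer (K : fieldType) (a : K) (m : nat) : K :=
  \prod_(i < m) (a + i%:R).

Definition gbinom (K : fieldType) (x : K) (k : nat) : K :=
  (\prod_(i < k) (x - i%:R)) / k`!%:R.

Lemma gbinom_pochhammer (K : fieldType) (a : K) (k : nat) :
  gbinom (k%:R + a) k = pochhammer (a + 1) k / k`!%:R.
Proof.
congr (_ / _); rewrite [LHS](reindex_inj rev_ord_inj) /=.
by apply: eq_bigr => i _; rewrite natrB // -natr1; ring.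
Qed.

(* Main.v *)
Require Import Defs.
From mathcomp Require Import all_boot all_order all_algebra.
From mathcomp Require Import reals.
From mathcomp Require Import complex ring zify.

(** The ratio of the two generalized binomials telescopes to
    (d + 1 + k) / (d + 1), so that d + 1 times the sum is affine in d, and
    writing the binomials as factorials the k-th summand becomes
<<
        2      n!         d + 1 + k
      ----- * ----- * ------------------- .
      d + 1    4^k    k! (k+2)! (n - 2k)!
>>
    Splitting d + 1 + k as (d - 1) + (k + 2) produces two sums of the form
<<
      sum_k  4^-k n! / (k! (k+m)! (n - 2k)!)      with m = 2 and m = 1
>>
    over the same range of k. Up to the factor (n + m)! these are sums of
    trinomial coefficients, since k + (k + m) + (n - 2k) = n + m; reading off
    the coefficient of X^n in both expansions of
<<
      (1 + X)^(2(n + m)) = ((1 + X^2) + 2 X)^(n + m)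
>>
    evaluates them as 2^-n n! 'C(2(n + m), n) / (n + m)! ([bin_double_trinomial]
    and [sum_inv_fact_trinomial]). Since (3/2)_n and (3)_n are also quotients of
    factorials, what remains is an identity of rational functions in n and d,
    namely
    2 (d - 1) (2n + 3) + (n + 3) (n + 4) = n^2 + n (4d + 3) + 6 (d + 1). *)

Set Implicit Arguments.
Unset Strict Implicit.
Unset Printing Implicit Defensive.

Import GRing.Theory Num.Theory.
Local Open Scope ring_scope.

(** Both sides are the coefficient of X^n in
    (1 + X)^(2(n + m)) = ((1 + X^2) + 2 X)^(n + m): choosing the summand 2 X
    in j of the factors leaves n + m - j factors 1 + X^2, of which k contribute
    X^2, and only the terms with j = n - 2k reach X^n. *)
Lemma bin_double_trinomial (m n : nat) :
  'C(2 * (n + m), n) = (\sum_(0 <= k < (n./2).+1)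
      'C(n + m, n - 2 * k) * 2 ^ (n - 2 * k) * 'C(2 * k + m, k))%N.
Proof.
have coef_expD1X p k : (((1 + 'X) ^+ p)`_k : int) = 'C(p, k)%:R.
  rewrite exprDn coef_sum.
  under eq_bigr => i _ do
    rewrite expr1n mul1r coefMn coefXn -mulrnA mulnC mulrnA mulrb.
  rewrite -big_mkcond /=.
  case: (ltnP k p.+1) => [kp|pk].
    by rewrite (big_pred1 (Ordinal kp)) // => i; rewrite -val_eqE eq_sym.
  rewrite big_pred0 ?bin_small // => i.
  by apply/negbTE/eqP => ki; have := ltn_ord i; lia.
apply/eqP; rewrite -(eqr_nat int) -coef_expD1X; apply/eqP.
set N := (n + m)%N.
have -> : (1 + 'X : {poly int}) ^+ (2 * N) = ((1 + 'X^2) + 'X *+ 2) ^+ N.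
  by rewrite exprM; congr (_ ^+ _); ring.
rewrite exprDn coef_sum.
(* Letting both indices range over a common square makes the order of
   summation exchangeable; the extra terms vanish with their binomials. *)
transitivity (\sum_(j < N.+1) \sum_(i < N.+1)
    if (j + 2 * i == n)%N then ('C(N, j) * 2 ^ j * 'C(N - j, i))%:R
    else 0 : int).
  apply: eq_bigr => j _.
  rewrite (exprDn 1 'X^2) mulr_suml -sumrMnl coef_sum.
  rewrite [RHS](bigID (fun i : 'I_N.+1 => (i < (N - j).+1)%N)) /=.
  rewrite [X in _ + X]big1 ?addr0.
    rewrite -(big_ord_widen N.+1 (fun i => if (j + 2 * i == n)%N then
       ('C(N, j) * 2 ^ j * 'C(N - j, i))%:R else 0)); last by lia.
    apply: eq_bigr => i _.
    rewrite expr1n mul1r -exprM exprMn_n mulrnAr mulrnAl -exprD -!mulrnA.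
    rewrite coefMn coefXn addnC eq_sym.
    by case: eqP => _; rewrite ?mul0rn //; congr (_%:R); lia.
  by move=> i; rewrite -leqNgt => ij; rewrite (bin_small ij) muln0 if_same.
rewrite exchange_big natr_sum big_mkord /=.
rewrite (big_ord_widen N.+1 (fun i => ('C(N, n - 2 * i) * 2 ^ (n - 2 * i)
   * 'C(2 * i + m, i))%:R : int)); last by rewrite /N; lia.
rewrite [RHS]big_mkcond; apply: eq_bigr => i _; rewrite -[LHS]big_mkcond.
case: ifP => hi; last by rewrite big_pred0 // => j; lia.
have hj : (n - 2 * i < N.+1)%N by rewrite /N; lia.
rewrite (big_pred1 (Ordinal hj)) => [|j]; last first.
  by apply/eqP/eqP => [e | ->]; [apply: val_inj => /= | rewrite /=]; lia.
by rewrite /=; congr (_ * 'C(_, _))%:R; lia.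
Qed.

Section NumField.

Variable K : numFieldType.

Lemma natr_fact_neq0 p : p`!%:R != 0 :> K.
Proof. by rewrite pnatr_eq0 -lt0n fact_gt0. Qed.

Lemma exp2r_neq0 p : 2 ^+ p != 0 :> K.
Proof. by rewrite expf_eq0 pnatr_eq0 andbF. Qed.

Lemma natr_bin_fact p q : (q <= p)%N ->
  'C(p, q)%:R = p`!%:R / (q`!%:R * (p - q)`!%:R) :> K.
Proof.
by move=> qp; rewrite -(bin_fact qp) !natrM mulfK // mulf_neq0 // natr_fact_neq0.
Qed.

(** [bin_double_trinomial] divided by 2^n (n + m)! / n!: the powers of 2 there
    have exponent n - 2k, which leaves 4^-k, and the product of the two binomials is the
    trinomial coefficient with parts k, k + m and n - 2k. *)
Lemma sum_inv_fact_trinomial (m n : nat) :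
  \sum_(0 <= k < (n./2).+1)
     n`!%:R / (2 ^+ (2 * k) * (k`! * (k + m)`! * (n - 2 * k)`!)%:R)
  = (n`! * 'C(2 * (n + m), n))%:R / (2 ^+ n * (n + m)`!%:R) :> K.
Proof.
rewrite bin_double_trinomial natrM natr_sum mulr_sumr mulr_suml.
apply: eq_big_nat => k /andP [_ hk].
rewrite !natrM natrX (@natr_bin_fact (n + m)) ?(@natr_bin_fact (2 * k + m));
  try lia.
have -> : (n + m - (n - 2 * k) = 2 * k + m)%N by lia.
have -> : (2 * k + m - k = k + m)%N by lia.
have -> : (2 ^+ n : K) = 2 ^+ (2 * k) * 2 ^+ (n - 2 * k).
  by rewrite -exprD; congr (_ ^+ _); lia.
field.
by rewrite !natr_fact_neq0 !exp2r_neq0.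
Qed.

Lemma pochhammer_three (n : nat) :
  pochhammer 3 n = (n + 2)`!%:R / 2 :> K.
Proof.
rewrite /pochhammer; elim: n => [|n IH].
  by rewrite big_ord0 divff // pnatr_eq0.
by rewrite big_ord_recr IH addSn factS natrM /=; field.
Qed.

(** (3/2)_n is the product of the odd numbers 3, ..., 2n + 1 over 2^n, and
    inserting the even factors 2, ..., 2n costs another 2^n n!. *)
Lemma pochhammer_three_halves (n : nat) :
  pochhammer (3 / 2) n = (2 * n + 1)`!%:R / (2 ^+ n * 2 ^+ n * n`!%:R) :> K.
Proof.
rewrite /pochhammer; elim: n => [|n IH].
  by rewrite big_ord0 !mulr1 divff // pnatr_eq0.
have -> : (2 * n.+1 + 1 = (2 * n + 1).+2)%N by lia.
rewrite big_ord_recr IH !factS !natrM exprS /=; field.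
by rewrite natr_fact_neq0 exp2r_neq0 -(natrD _ 1 n) pnatr_eq0.
Qed.

End NumField.

(** The rising factorials of d + 2 and d + 1 share all factors but the last
    one and the first one. *)
Lemma gbinom_ratio (K : fieldType) (d : K) (k : nat) :
    (forall m : nat, d <> - m%:R) -> k`!%:R != 0 :> K ->
  gbinom (k%:R + d + 1) k / gbinom (k%:R + d) k = (d + 1 + k%:R) / (d + 1).
Proof.
move=> hd f0.
have dn0 i : d + 1 + i%:R != 0.
  apply/eqP => e; apply: (hd i.+1); rewrite -natr1.
  by apply/eqP; rewrite -subr_eq0 -e; apply/eqP; ring.
have shift : (d + 1) * pochhammer (d + 1 + 1) k
    = pochhammer (d + 1) k * (d + 1 + k%:R).
  transitivity (\prod_(i < k.+1) (d + 1 + i%:R)); last by rewrite big_ord_recr.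
  rewrite big_ord_recl addr0.
  by congr (_ * _); apply: eq_bigr => i _; rewrite /bump -natr1 /=; ring.
have p0 : pochhammer (d + 1) k != 0 by apply/prodf_neq0 => i _.
have d0 : d + 1 != 0 by have := dn0 0%N; rewrite addr0.
rewrite -addrA !gbinom_pochhammer invf_div mulrA divfK //.
by apply/eqP; rewrite eqr_div // mulrC shift mulrC.
Qed.

Theorem theorem4p4 (R : realType) (d : R[i]) (n : nat)
    (hd : forall m : nat, d <> - m%:R) :
  \sum_(0 <= k < (n./2).+1)
     1 / 2 ^+ (2 * k)
     * (gbinom (k%:R + d + 1) k / gbinom (k%:R + d) k)
     * ('C(2 * k, k)%:R / 'C(k + 2, k)%:R)
     * 'C(n, 2 * k)%:R
  = 2 ^+ n.+1 / (d + 1)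
    * ((n%:R ^+ 2 + n%:R * (4 * d + 3) + 6 * (d + 1))
       / ((n%:R + 3) * (n%:R + 4)))
    * (pochhammer (3 / 2) n / pochhammer 3 n).
Proof.
have nD0 i j : i.+1%:R + j%:R != 0 :> R[i] by rewrite -natrD pnatr_eq0.
have d0 : d + 1 != 0 by apply/eqP => /eqP; rewrite addr_eq0 => /eqP /(hd 1%N).
pose w m k : R[i] :=
  n`!%:R / (2 ^+ (2 * k) * (k`! * (k + m)`! * (n - 2 * k)`!)%:R).
(* This is the splitting d + 1 + k = (d - 1) + (k + 2); the factor k + 2 turns
   (k + 2)! into (k + 1)!. *)
transitivity (\sum_(0 <= k < (n./2).+1)
    2 / (d + 1) * ((d - 1) * w 2%N k + w 1%N k)).
  apply: eq_big_nat => k /andP [_ hk].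
  rewrite gbinom_ratio ?natr_fact_neq0 // !natr_bin_fact; try lia.
  have -> : (2 * k - k = k)%N by lia.
  rewrite addKn /w addn2 addn1 !factS fact0 !natrM !mulr1; field.
  by rewrite !natr_fact_neq0 exp2r_neq0 d0 (nD0 0%N) (nD0 1%N).
rewrite -mulr_sumr big_split -mulr_sumr /= !sum_inv_fact_trinomial.
rewrite pochhammer_three pochhammer_three_halves.
rewrite !natrM !natr_bin_fact; try lia.
(* Every factorial is reduced to n! or (2n + 1)!, so that a rational identity
   in n and d is left. *)
have -> : (2 * (n + 2) - n = n.+4)%N by lia.
have -> : (2 * (n + 1) - n = n.+2)%N by lia.
have -> : (2 * (n + 2) = (2 * n + 1).+3)%N by lia.
have -> : (2 * (n + 1) = (2 * n + 1).+1)%N by lia.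
rewrite addn2 (addn1 n) !factS !natrM exprS; field.
rewrite !natr_fact_neq0 exp2r_neq0 d0 (nD0 0%N) (nD0 1%N).
by rewrite ![n%:R + _]addrC (nD0 2%N) (nD0 3%N).
Qed.
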